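(* Let $\mathsf{C}$ be a Markov category and $\mathsf{D}$ a small category. Then $\mathrm{Fun}(\mathsf{D},\mathsf{C})$ is again a Markov category with respect to the pointwise monoidal structure: for $X,Y\in\mathrm{Fun}(\mathsf{D},\mathsf{C})$ one puts $(X\otimes Y)_d:=X_d\otimes Y_d$, with the obvious action on morphisms of $\mathsf{D}$, and similarly for the tensor product of morphisms; and the comultiplications are also defined pointwise, $(\mathsf{copy}_X)_d:=\mathsf{copy}_{X_d}:X_d\to X_d\otimes X_d$.
   Context: A Markov category is a symmetric monoidal category $(\mathsf{C},\otimes,I)$ with symmetry $\mathsf{swap}_{X,Y}:X\otimes Y\to Y\otimes X$, in which every object $X$ is equipped with morphisms $\mathsf{copy}_X:X\to X\otimes X$ and $\mathsf{del}_X:X\to I$ forming a commutative comonoid (coassociative, counital, cocommutative, with respect to the associators, unitors and symmetry), such that: (i) $\mathsf{del}_{X\otimes Y}$ is $\mathsf{del}_X\otimes\mathsf{del}_Y$ followed by $I\otimes I\cong I$; (ii) $\mathsf{copy}_{X\otimes Y}$ is $\mathsf{copy}_X\otimes\mathsf{copy}_Y$ followed by the canonical isomorphism $(X\otimes X)\otimes(Y\otimes Y)\cong(X\otimes Y)\otimes(X\otimes Y)$ built from associators and the symmetry on the two middle factors; (iii) $\mathsf{del}_Y\circ f=\mathsf{del}_X$ for every $f:X\to Y$. A morphism $f:X\to Y$ in a Markov category is deterministic if $\mathsf{copy}_Y\circ f=(f\otimes f)\circ\mathsf{copy}_X$. The deterministic morphisms form a symmetric monoidal subcategory $\mathsf{C}_{\mathrm{det}}\subseteq\mathsf{C}$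 with the same objects. For a Markov category $\mathsf{C}$ and a small category $\mathsf{D}$, the category $\mathrm{Fun}(\mathsf{D},\mathsf{C})$ has as objects the functors $X=(X_d)_{d\in\mathsf{D}}:\mathsf{D}\to\mathsf{C}_{\mathrm{det}}$, and as morphisms the natural transformations between these functors considered as functors to $\mathsf{C}$ (i.e. with components that are not necessarily deterministic morphisms of $\mathsf{C}$). *)

(* Defs.v *)
(* Morphisms are compared by Leibniz equality; functional extensionality and
   proof irrelevance make equality of natural transformations the same as
   equality of components. *)
From Stdlib Require Import FunctionalExtensionality ProofIrrelevance.

Set Implicit Arguments.
Unset Strict Implicit.
Unset Printing Implicit Defensive.

Declare Scope cat_scope.
Delimit Scope cat_scope with cat.
Local Open Scope cat_scope.

Record Category := {
  Ob :> Type;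
  Hom : Ob -> Ob -> Type;
  idm : forall A, Hom A A;
  comp : forall A B C, Hom B C -> Hom A B -> Hom A C;
  comp_idl : forall A B (f : Hom A B), comp (idm B) f = f;
  comp_idr : forall A B (f : Hom A B), comp f (idm A) = f;
  comp_assoc : forall A B C D (h : Hom C D) (g : Hom B C) (f : Hom A B),
    comp h (comp g f) = comp (comp h g) f
}.

Arguments Hom {c} A B.
Arguments idm {c} A.
Arguments comp {c A B C} g f.

Notation "g ∘ f" := (comp g f) (at level 40, left associativity) : cat_scope.

Record Functor (D C : Category) := {
  fob :> D -> C;
  fmap : forall d e : D, Hom d e -> Hom (fob d) (fob e);
  fmap_id : forall d, fmap (idm d) = idm (fob d);
  fmap_comp : forall d e k (v : Hom e k) (u : Hom d e),
    fmap (v ∘ u) = fmap v ∘ fmap u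
}.

Arguments fmap {D C} F {d e} u : rename.

Definition fcompose (A B C : Category) (G : Functor B C) (F : Functor A B) :
  Functor A C.
Proof.
refine {| fob := fun a => G (F a); fmap := fun a b u => fmap G (fmap F u) |}.
- intros a; rewrite fmap_id; apply fmap_id.
- intros a b c v u; rewrite fmap_comp; apply fmap_comp.
Defined.

Record NatTrans (D C : Category) (F G : Functor D C) := {
  ntc :> forall d : D, Hom (F d) (G d);
  ntc_natural : forall d e (u : Hom d e), ntc e ∘ fmap F u = fmap G u ∘ ntc d
}.

Lemma nat_trans_eq (D C : Category) (F G : Functor D C) (s t : NatTrans F G) :
  (forall d, s d = t d) -> s = t.
Proof.
destruct s as [s hs], t as [t ht]; simpl; intros E.
assert (E' : s = t) by (apply functional_extensionality_dep; exact E).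
subst t; f_equal; apply proof_irrelevance.
Qed.

Definition nat_id (D C : Category) (F : Functor D C) : NatTrans F F.
Proof.
refine {| ntc := fun d => idm (F d) |}.
intros d e u; rewrite comp_idl, comp_idr; reflexivity.
Defined.

Definition nat_comp (D C : Category) (F G H : Functor D C)
  (t : NatTrans G H) (s : NatTrans F G) : NatTrans F H.
Proof.
refine {| ntc := fun d => t d ∘ s d |}.
intros d e u.
rewrite <- comp_assoc, ntc_natural, comp_assoc, ntc_natural, comp_assoc.
reflexivity.
Defined.

Class SymMonoidal (C : Category) := {
  munit : C;
  tens : C -> C -> C;
  tensm : forall A B A' B' : C,
    Hom A B -> Hom A' B' -> Hom (tens A A') (tens B B');
  assoc : forall A B C : C, Hom (tens (tens A B) C) (tens A (tens B C));
  assoc_inv : forall A B C : C, Hom (tens A (tens B C)) (tens (tens A B) C);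
  lunit : forall A : C, Hom (tens munit A) A;
  lunit_inv : forall A : C, Hom A (tens munit A);
  runit : forall A : C, Hom (tens A munit) A;
  runit_inv : forall A : C, Hom A (tens A munit);
  swap : forall A B : C, Hom (tens A B) (tens B A);

  tensm_id : forall A B : C, tensm (idm A) (idm B) = idm (tens A B);
  tensm_comp : forall (A B K A' B' K' : C) (g : Hom B K) (f : Hom A B)
    (g' : Hom B' K') (f' : Hom A' B'),
    tensm (g ∘ f) (g' ∘ f') = tensm g g' ∘ tensm f f';

  assoc_invl : forall A B C : C, assoc_inv A B C ∘ assoc A B C = idm _;
  assoc_invr : forall A B C : C, assoc A B C ∘ assoc_inv A B C = idm _;
  assoc_natural : forall (A B K A' B' K' : C)
    (f : Hom A A') (g : Hom B B') (h : Hom K K'),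
    assoc A' B' K' ∘ tensm (tensm f g) h
    = tensm f (tensm g h) ∘ assoc A B K;

  lunit_invl : forall A : C, lunit_inv A ∘ lunit A = idm _;
  lunit_invr : forall A : C, lunit A ∘ lunit_inv A = idm _;
  lunit_natural : forall (A B : C) (f : Hom A B),
    lunit B ∘ tensm (idm munit) f = f ∘ lunit A;

  runit_invl : forall A : C, runit_inv A ∘ runit A = idm _;
  runit_invr : forall A : C, runit A ∘ runit_inv A = idm _;
  runit_natural : forall (A B : C) (f : Hom A B),
    runit B ∘ tensm f (idm munit) = f ∘ runit A;

  swap_natural : forall (A B A' B' : C) (f : Hom A A') (g : Hom B B'),
    swap A' B' ∘ tensm f g = tensm g f ∘ swap A B;
  swap_swap : forall A B : C, swap B A ∘ swap A B = idm _;

  pentagon : forall A B K L : C,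
    assoc A B (tens K L) ∘ assoc (tens A B) K L
    = tensm (idm A) (assoc B K L) ∘ assoc A (tens B K) L
        ∘ tensm (assoc A B K) (idm L);
  triangle : forall A B : C,
    tensm (idm A) (lunit B) ∘ assoc A munit B = tensm (runit A) (idm B);
  (* the second hexagon follows from this one and [swap_swap] *)
  hexagon : forall A B K : C,
    assoc B K A ∘ swap A (tens B K) ∘ assoc A B K
    = tensm (idm B) (swap A K) ∘ assoc B A K ∘ tensm (swap A B) (idm K)
}.

Notation "A ⊗ B" := (tens A B) (at level 38, left associativity) : cat_scope.
Notation "f ⊠ g" := (tensm f g) (at level 38, left associativity) : cat_scope.

(* (A ⊗ A') ⊗ (B ⊗ B') ≅ (A ⊗ B) ⊗ (A' ⊗ B'), exchanging A' and B *)
Definition middle_swap (C : Category) (S : SymMonoidal C) (A A' B B' : C) :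
  Hom ((A ⊗ A') ⊗ (B ⊗ B')) ((A ⊗ B) ⊗ (A' ⊗ B')) :=
  assoc_inv A B (A' ⊗ B')
    ∘ idm A ⊠ (assoc B A' B' ∘ swap A' B ⊠ idm B' ∘ assoc_inv A' B B')
    ∘ assoc A A' (B ⊗ B').

Arguments middle_swap {C S} A A' B B'.

Class Markov (C : Category) := {
  markov_sym_monoidal :: SymMonoidal C;
  copy : forall A : C, Hom A (A ⊗ A);
  del : forall A : C, Hom A munit;

  copy_assoc : forall A : C,
    assoc A A A ∘ copy A ⊠ idm A ∘ copy A = idm A ⊠ copy A ∘ copy A;
  copy_counitl : forall A : C, lunit A ∘ del A ⊠ idm A ∘ copy A = idm A;
  copy_counitr : forall A : C, runit A ∘ idm A ⊠ del A ∘ copy A = idm A;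
  copy_comm : forall A : C, swap A A ∘ copy A = copy A;

  del_tens : forall A B : C, del (A ⊗ B) = lunit munit ∘ del A ⊠ del B;
  copy_tens : forall A B : C,
    copy (A ⊗ B) = middle_swap A A B B ∘ copy A ⊠ copy B;
  del_natural : forall (A B : C) (f : Hom A B), del B ∘ f = del A
}.

Definition deterministic (C : Category) (M : Markov C) (A B : C)
  (f : Hom A B) : Prop :=
  copy B ∘ f = f ⊠ f ∘ copy A.

Arguments deterministic {C M A B} f.

Lemma deterministic_id (C : Category) (M : Markov C) (A : C) :
  deterministic (idm A).
Proof.
unfold deterministic; rewrite tensm_id, comp_idl, comp_idr; reflexivity.
Qed.

Lemma deterministic_comp (C : Category) (M : Markov C) (A B K : C)
  (g : Hom B K) (f : Hom A B) :
  deterministic g -> deterministic f -> deterministic (g ∘ f).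
Proof.
unfold deterministic; intros hg hf.
rewrite comp_assoc, hg, <- comp_assoc, hf, comp_assoc, <- tensm_comp.
reflexivity.
Qed.

Lemma det_hom_eq (C : Category) (M : Markov C) (A B : C)
  (f g : {f : Hom A B | deterministic f}) : proj1_sig f = proj1_sig g -> f = g.
Proof.
destruct f as [f hf], g as [g hg]; simpl; intros E; subst g.
f_equal; apply proof_irrelevance.
Qed.

Definition Det (C : Category) (M : Markov C) : Category.
Proof.
refine {|
  Ob := C;
  Hom := fun A B => {f : Hom A B | deterministic f};
  idm := fun A => exist _ (idm A) (deterministic_id M A);
  comp := fun A B K g f =>
    exist _ (proj1_sig g ∘ proj1_sig f)
      (deterministic_comp (proj2_sig g) (proj2_sig f)) |}.
- intros A B f; apply det_hom_eq, comp_idl.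
- intros A B f; apply det_hom_eq, comp_idr.
- intros A B K L h g f; apply det_hom_eq, comp_assoc.
Defined.

Definition det_incl (C : Category) (M : Markov C) : Functor (Det M) C.
Proof.
refine (@Build_Functor (Det M) C (fun A => A) (fun A B f => proj1_sig f) _ _).
- reflexivity.
- reflexivity.
Defined.

(* A functor to C_det, considered as a functor to C. *)
Definition underlying (D C : Category) (M : Markov C) (X : Functor D (Det M)) :
  Functor D C := fcompose (det_incl M) X.

(* There is a single universe level for categories, so the category D below is
   arbitrary; in particular every small category is covered. *)
Definition Fun (D C : Category) (M : Markov C) : Category.
Proof.
refine {|
  Ob := Functor D (Det M);
  Hom := fun X Y => NatTrans (underlying X) (underlying Y);
  idm := fun X => nat_id (underlying X);
  comp := fun X Y Z t s => nat_comp t s |}.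
- intros X Y s; apply nat_trans_eq; intros d; apply comp_idl.
- intros X Y s; apply nat_trans_eq; intros d; apply comp_idr.
- intros X Y Z W r t s; apply nat_trans_eq; intros d; apply comp_assoc.
Defined.

Arguments Fun D C {M}.

Section Evaluation.
Context {D C : Category} {M : Markov C}.

Definition ev_ob (X : Fun D C) (d : D) : C := underlying X d.

Definition ev_map (X : Fun D C) (d e : D) (u : Hom d e) :
  Hom (ev_ob X d) (ev_ob X e) := fmap (underlying X) u.

Definition ev_hom (X Y : Fun D C) (s : Hom X Y) (d : D) :
  Hom (ev_ob X d) (ev_ob Y d) := ntc s d.

End Evaluation.

(* Equality of arrows whose domains and codomains are equal, but not
   necessarily by conversion. *)
Inductive arrow_eq (C : Category) (A B : C) (f : Hom A B) :
  forall A' B' : C, Hom A' B' -> Prop :=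
| arrow_eq_refl : arrow_eq f f.

Notation "f ≡ g" := (arrow_eq f g) (at level 70, no associativity) : cat_scope.

(* A Markov structure on Fun(D, C) is pointwise when each of its operations is
   computed in C at every object d of D. The inverses of the associators and
   unitors are then pointwise too, by uniqueness of inverses. *)
Record pointwise (D C : Category) (M : Markov C) (N : Markov (Fun D C)) :
  Prop := {
  pw_tens_ob : forall (X Y : Fun D C) (d : D),
    ev_ob (X ⊗ Y) d = ev_ob X d ⊗ ev_ob Y d;
  pw_tens_map : forall (X Y : Fun D C) (d e : D) (u : Hom d e),
    ev_map (X ⊗ Y) u ≡ ev_map X u ⊠ ev_map Y u;
  pw_tens_hom : forall (X Y X' Y' : Fun D C) (s : Hom X Y) (t : Hom X' Y')
    (d : D), ev_hom (s ⊠ t) d ≡ ev_hom s d ⊠ ev_hom t d;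

  pw_unit_ob : forall d : D, ev_ob (munit : Fun D C) d = munit;
  pw_unit_map : forall (d e : D) (u : Hom d e),
    ev_map (munit : Fun D C) u ≡ idm (munit : C);

  pw_assoc : forall (X Y Z : Fun D C) (d : D),
    ev_hom (assoc X Y Z) d ≡ assoc (ev_ob X d) (ev_ob Y d) (ev_ob Z d);
  pw_lunit : forall (X : Fun D C) (d : D),
    ev_hom (lunit X) d ≡ lunit (ev_ob X d);
  pw_runit : forall (X : Fun D C) (d : D),
    ev_hom (runit X) d ≡ runit (ev_ob X d);
  pw_swap : forall (X Y : Fun D C) (d : D),
    ev_hom (swap X Y) d ≡ swap (ev_ob X d) (ev_ob Y d);

  pw_copy : forall (X : Fun D C) (d : D),
    ev_hom (copy X) d ≡ copy (ev_ob X d);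
  pw_del : forall (X : Fun D C) (d : D),
    ev_hom (del X) d ≡ del (ev_ob X d)
}.

(* Main.v *)
(* Only the naturality of the structure maps of Fun(D, C) needs an argument,
   since every axiom is an equality of components. The coherence maps are
   natural because they are so in C; the deletions are natural because C is
   semicartesian; the copy maps are natural precisely because the objects of
   Fun(D, C) are functors to C_det. That tensor products of such functors again
   land in C_det follows from [copy_tens] and the naturality of the middle
   swap. *)
Require Import Defs.

Set Implicit Arguments.
Unset Strict Implicit.
Unset Printing Implicit Defensive.
Local Open Scope cat_scope.

(** Naturality passes to inverses: insert [i ∘ j] to the right of [l ∘ g], replace [g ∘ i] by
    [k ∘ f], and cancel [l ∘ k]. *)
Lemma inverse_natural (C : Category) (A A' B B' : C)
  (i : Hom A A') (j : Hom A' A) (k : Hom B B') (l : Hom B' B)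
  (f : Hom A B) (g : Hom A' B') :
  i ∘ j = idm A' -> l ∘ k = idm B -> k ∘ f = g ∘ i -> l ∘ g = f ∘ j.
Proof.
intros ij lk E.
rewrite <- (comp_idr (l ∘ g)), <- ij, comp_assoc, <- (comp_assoc l g i), <- E.
rewrite comp_assoc, lk, comp_idl; reflexivity.
Qed.

Section SymMonoidalNaturality.
Context {C : Category} {S : SymMonoidal C}.

Lemma assoc_inv_natural (A B K A' B' K' : C)
  (f : Hom A A') (g : Hom B B') (h : Hom K K') :
  assoc_inv A' B' K' ∘ f ⊠ (g ⊠ h) = f ⊠ g ⊠ h ∘ assoc_inv A B K.
Proof.
exact (inverse_natural (assoc_invr A B K) (assoc_invl A' B' K')
  (assoc_natural f g h)).
Qed.

Lemma lunit_inv_natural (A B : C) (f : Hom A B) :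
  lunit_inv B ∘ f = idm munit ⊠ f ∘ lunit_inv A.
Proof.
exact (inverse_natural (lunit_invr A) (lunit_invl B) (lunit_natural f)).
Qed.

Lemma runit_inv_natural (A B : C) (f : Hom A B) :
  runit_inv B ∘ f = f ⊠ idm munit ∘ runit_inv A.
Proof.
exact (inverse_natural (runit_invr A) (runit_invl B) (runit_natural f)).
Qed.

(** The square is pasted from the naturality squares of the associators, their inverses and the
    symmetry. *)
Lemma middle_swap_natural (A A' B B' K K' L L' : C)
  (f : Hom A K) (f' : Hom A' K') (g : Hom B L) (g' : Hom B' L') :
  middle_swap K K' L L' ∘ (f ⊠ f') ⊠ (g ⊠ g')
  = (f ⊠ g) ⊠ (f' ⊠ g') ∘ middle_swap A A' B B'.
Proof.
unfold middle_swap.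
set (m := assoc L K' L' ∘ _ ∘ _); set (n := assoc B A' B' ∘ _ ∘ _).
(* Naturality of the inner composite on the last three factors; below it is tensored with [f] on the
   left. *)
assert (E : m ∘ f' ⊠ (g ⊠ g') = g ⊠ (f' ⊠ g') ∘ n).
{ unfold m, n.
  rewrite <- comp_assoc, assoc_inv_natural, comp_assoc.
  rewrite <- (comp_assoc (assoc L K' L')), <- tensm_comp, swap_natural.
  (* The identity beside the swap moves from the left of [g'] to its right, so that interchange
     splits off the swap as the first map applied. The same device serves for [f] below. *)
  rewrite comp_idl, <- (comp_idr g'), tensm_comp, comp_idr.
  rewrite comp_assoc, assoc_natural, !comp_assoc; reflexivity. }
rewrite <- comp_assoc, assoc_natural, comp_assoc.
rewrite <- (comp_assoc (assoc_inv K L _)), <- tensm_comp, E.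
rewrite comp_idl, <- (comp_idr f), tensm_comp, comp_idr.
rewrite comp_assoc, assoc_inv_natural, !comp_assoc; reflexivity.
Qed.

End SymMonoidalNaturality.

Lemma deterministic_tens (C : Category) (M : Markov C) (A B A' B' : C)
  (f : Hom A B) (g : Hom A' B') :
  deterministic f -> deterministic g -> deterministic (f ⊠ g).
Proof.
unfold deterministic; intros hf hg.
rewrite !copy_tens, <- comp_assoc, <- tensm_comp, hf, hg, tensm_comp.
rewrite !comp_assoc, middle_swap_natural; reflexivity.
Qed.

Section Pointwise.
Context {D C : Category} {M : Markov C}.

Definition fun_unit : Fun D C.
Proof.
refine (@Build_Functor D (Det M) (fun _ => munit : C)
  (fun _ _ _ => idm (_ : Det M)) _ _).
- reflexivity.
- intros d e k v u; symmetry; apply comp_idl.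
Defined.

Definition fun_tens (X Y : Fun D C) : Fun D C.
Proof.
refine (@Build_Functor D (Det M) (fun d => ev_ob X d ⊗ ev_ob Y d)
  (fun d e u => exist _ (ev_map X u ⊠ ev_map Y u)
    (deterministic_tens (proj2_sig (fmap X u)) (proj2_sig (fmap Y u)))) _ _).
- intros d; apply det_hom_eq; unfold ev_map; simpl.
  rewrite !fmap_id; apply tensm_id.
- intros d e k v u; apply det_hom_eq; unfold ev_map; simpl.
  rewrite !fmap_comp; apply tensm_comp.
Defined.

(** Phrasing naturality through [ev_ob] and [ev_map] lets the naturality laws of [C] be supplied
    directly, up to conversion. *)
Definition fun_hom (X Y : Fun D C) (s : forall d, Hom (ev_ob X d) (ev_ob Y d))
  (n : forall (d e : D) (u : Hom d e), s e ∘ ev_map X u = ev_map Y u ∘ s d) :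
  Hom X Y :=
  @Build_NatTrans D C (underlying X) (underlying Y) s n.

Definition fun_tensm (X Y X' Y' : Fun D C) (s : Hom X Y) (t : Hom X' Y') :
  Hom (fun_tens X X') (fun_tens Y Y').
Proof.
refine (@fun_hom (fun_tens X X') (fun_tens Y Y')
  (fun d => ev_hom s d ⊠ ev_hom t d) _).
intros d e u; change (ev_hom s e ⊠ ev_hom t e ∘ ev_map X u ⊠ ev_map X' u
  = ev_map Y u ⊠ ev_map Y' u ∘ ev_hom s d ⊠ ev_hom t d).
rewrite <- !tensm_comp; f_equal; apply ntc_natural.
Defined.

Definition fun_sym_monoidal : SymMonoidal (Fun D C).
Proof.
refine (@Build_SymMonoidal (Fun D C) fun_unit fun_tens fun_tensm
  (fun X Y Z => @fun_hom (fun_tens (fun_tens X Y) Z)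
    (fun_tens X (fun_tens Y Z)) (fun d => assoc _ _ _)
    (fun d e u => assoc_natural _ _ _))
  (fun X Y Z => @fun_hom (fun_tens X (fun_tens Y Z))
    (fun_tens (fun_tens X Y) Z) (fun d => assoc_inv _ _ _)
    (fun d e u => assoc_inv_natural _ _ _))
  (fun X => @fun_hom (fun_tens fun_unit X) X (fun d => lunit _)
    (fun d e u => lunit_natural _))
  (fun X => @fun_hom X (fun_tens fun_unit X) (fun d => lunit_inv _)
    (fun d e u => lunit_inv_natural _))
  (fun X => @fun_hom (fun_tens X fun_unit) X (fun d => runit _)
    (fun d e u => runit_natural _))
  (fun X => @fun_hom X (fun_tens X fun_unit) (fun d => runit_inv _)
    (fun d e u => runit_inv_natural _))
  (fun X Y => @fun_hom (fun_tens X Y) (fun_tens Y X) (fun d => swap _ _)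
    (fun d e u => swap_natural _ _))
  _ _ _ _ _ _ _ _ _ _ _ _ _ _ _ _);
intros; apply nat_trans_eq; intros d.
- apply tensm_id.
- apply tensm_comp.
- exact (assoc_invl (ev_ob A d) (ev_ob B d) _).
- exact (assoc_invr (ev_ob A d) (ev_ob B d) _).
- exact (assoc_natural (ev_hom f d) (ev_hom g d) (ev_hom h d)).
- apply lunit_invl.
- apply lunit_invr.
- exact (lunit_natural (ev_hom f d)).
- apply runit_invl.
- apply runit_invr.
- exact (runit_natural (ev_hom f d)).
- apply swap_natural.
- apply swap_swap.
- exact (pentagon (ev_ob A d) (ev_ob B d) (ev_ob K d) (ev_ob L d)).
- exact (triangle (ev_ob A d) (ev_ob B d)).
- exact (hexagon (ev_ob A d) (ev_ob B d) (ev_ob K d)).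
Defined.

(** The factor [idm munit] is the action of [fun_unit] on [u], which makes this the naturality
    square of the deletion. *)
Lemma fun_del_natural (X : Fun D C) (d e : D) (u : Hom d e) :
  del (ev_ob X e) ∘ ev_map X u = idm munit ∘ del (ev_ob X d).
Proof. rewrite comp_idl; apply del_natural. Qed.

Definition fun_markov : Markov (Fun D C).
Proof.
refine (@Build_Markov (Fun D C) fun_sym_monoidal
  (fun X => @fun_hom X (fun_tens X X) (fun d => copy _)
    (* The naturality square of [copy] at [u] is, by conversion, the determinism proof carried by
       [fmap X u]. *)
    (fun d e u => proj2_sig (fmap X u)))
  (fun X => @fun_hom X fun_unit (fun d => del _)
    (@fun_del_natural X))
  _ _ _ _ _ _ _);
intros; apply nat_trans_eq; intros d.
- apply copy_assoc.
- apply copy_counitl.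
- apply copy_counitr.
- apply copy_comm.
- apply del_tens.
- exact (copy_tens (ev_ob A d) (ev_ob B d)).
- apply del_natural.
Defined.

(** The constructions above are transparent, so domains, codomains and arrows all agree by
    conversion. *)
Lemma fun_markov_pointwise : pointwise fun_markov.
Proof. constructor; intros; reflexivity || exact (arrow_eq_refl _). Qed.

End Pointwise.

Theorem proposition7p1 (C : Category) (M : Markov C) (D : Category) :
  exists N : Markov (Fun D C), pointwise N.
Proof. exact (ex_intro _ fun_markov fun_markov_pointwise). Qed.
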